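(* Let $n\ge 2$ and $\theta(z)=z^n$. With respect to the basis $e_j=z^j$, $0\le j\le n-1$, of $\mathcal{K}_\theta$, the space $\mathcal{I}_{z^n}=\mathcal{T}_\theta\cap\mathcal{H}_\theta$ equals the set of $n\times n$ complex matrices that are both Toeplitz and Hankel, and it is spanned by the two linearly independent checkerboard matrices $$(E_{\mathrm{even}})_{ij}=\begin{cases}1,& i+j\text{ even},\\0,& i+j\text{ odd},\end{cases}\qquad (E_{\mathrm{odd}})_{ij}=\begin{cases}0,& i+j\text{ even},\\1,& i+j\text{ odd},\end{cases}\qquad 0\le i,j\le n-1.$$ Hence $\dim\mathcal{I}_{z^n}=2$.
   Context: $\mathbb{T}$ is the unit circle with normalized Lebesgue measure, $L^2=L^2(\mathbb{T})$, $H^2\subset L^2$ is the Hardy space, $H^2_-=L^2\ominus H^2$, and $P_{H^2_-}$ is the orthogonal projection onto $H^2_-$. For an inner function $\theta$, the model space is $\mathcal{K}_\theta=H^2\ominus\theta H^2$ and $P_{\mathcal{K}_\theta}:L^2\to\mathcal{K}_\theta$ is the orthogonal projection; for $\theta=z^n$, $\mathcal{K}_\theta=\operatorname{span}\{1,z,\dots,z^{n-1}\}$. For $\varphi\in L^\infty(\mathbb{T})$ the truncated Toeplitz operator is $A_\varphi f=P_{\mathcal{K}_\theta}(\varphi f)$, $f\in\mathcal{K}_\theta$, and the truncated Hankel operator is $B_\varphi f=P_{\mathcal{K}_\theta}JP_{H^2_-}(\varphi f)$, $f\in\mathcal{K}_\theta$, where $J:L^2\to L^2$ is the unitary $(Jf)(z)=\bar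 z f(\bar z)$. $\mathcal{T}_\theta$ and $\mathcal{H}_\theta$ are the sets of all truncated Toeplitz and all truncated Hankel operators on $\mathcal{K}_\theta$. Operators are identified with their matrices $M_{ij}=\langle Me_j,e_i\rangle$. A matrix $(M_{ij})_{i,j=0}^{n-1}$ is Toeplitz if $M_{ij}$ depends only on $i-j$, and Hankel if $M_{ij}$ depends only on $i+j$. *)

(* Defs.v *)
From HB Require Import structures.
From mathcomp Require Import all_boot all_order all_algebra.
From mathcomp Require Import complex.
From mathcomp Require Import all_classical all_reals all_analysis.

Set Implicit Arguments.
Unset Strict Implicit.
Unset Printing Implicit Defensive.

Import Order.TTheory GRing.Theory Num.Theory.

Local Open Scope classical_set_scope.
Local Open Scope ring_scope.

(* The circle is parametrized by t |-> exp (2 i pi t), for t in [0, 1], so that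
   Lebesgue measure on [0, 1] induces the normalized Lebesgue measure on the
   circle.  A function on the circle is represented by a total function
   R[i] -> R[i]; its values outside the unit circle are never looked at, and
   elements of L^2 are handled through their representatives: every notion
   below is invariant under almost everywhere equality. *)

Definition circle_pt (R : realType) (t : R) : R[i] :=
  Complex (cos (2 * pi * t)) (sin (2 * pi * t)).

Definition circle_int (R : realType) (f : R[i] -> R[i]) : R[i] :=
  Complex
    (\int[@lebesgue_measure R]_(t in (`[0, 1] : set R))
        complex.Re (f (circle_pt t)))
    (\int[@lebesgue_measure R]_(t in (`[0, 1] : set R))
        complex.Im (f (circle_pt t))).

Definition circle_measurable (R : realType) (f : R[i] -> R[i]) : Prop :=
  measurable_fun (`[0, 1] : set R) (fun t : R => complex.Re (f (circle_pt t))) /\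
  measurable_fun (`[0, 1] : set R) (fun t : R => complex.Im (f (circle_pt t))).

Definition L2 (R : realType) : set (R[i] -> R[i]) :=
  [set f | circle_measurable f /\
     (@lebesgue_measure R).-integrable (`[0, 1] : set R)
       (fun t : R => (ComplexField.Normc.normc (f (circle_pt t)) ^+ 2)%:E)].
Arguments L2 : clear implicits.

Definition Linfty (R : realType) : set (R[i] -> R[i]) :=
  [set f | circle_measurable f /\
     exists M : R, {ae @lebesgue_measure R, forall t : R, 0 <= t <= 1 ->
       ComplexField.Normc.normc (f (circle_pt t)) <= M}].
Arguments Linfty : clear implicits.

Definition inner_prod (R : realType) (f g : R[i] -> R[i]) : R[i] :=
  circle_int (fun z => f z * conjc (g z)).

Definition L2norm (R : realType) (f : R[i] -> R[i]) : R :=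
  Num.sqrt (complex.Re (inner_prod f f)).

(* The closed linear span in L^2 of the monomials z^k, k >= 0. *)
Definition H2 (R : realType) : set (R[i] -> R[i]) :=
  [set f | L2 R f /\
     forall e : R, 0 < e -> exists p : {poly R[i]}, L2norm (f \- horner p) < e].
Arguments H2 : clear implicits.

(* S (-) U *)
Definition ominus (R : realType) (S U : set (R[i] -> R[i])) :
    set (R[i] -> R[i]) :=
  [set f | S f /\ forall g, U g -> inner_prod f g = 0].

Definition H2minus (R : realType) : set (R[i] -> R[i]) :=
  ominus (L2 R) (H2 R).
Arguments H2minus : clear implicits.

Definition model_space (R : realType) (theta : R[i] -> R[i]) :
    set (R[i] -> R[i]) :=
  ominus (H2 R) [set theta \* h | h in H2 R].

(* The graph of the orthogonal projection P_S : "g = P_S f" up to almost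
   everywhere equality. *)
Definition is_orth_proj (R : realType) (S : set (R[i] -> R[i]))
    (f g : R[i] -> R[i]) : Prop :=
  S g /\ forall h, S h -> inner_prod (f \- g) h = 0.

Definition Jop (R : realType) (f : R[i] -> R[i]) : R[i] -> R[i] :=
  fun z => conjc z * f (conjc z).

(* Operators on the model space are total maps on representatives, of which
   only the restriction to the model space matters. *)
Definition is_truncated_Toeplitz (R : realType) (theta phi : R[i] -> R[i])
    (A : (R[i] -> R[i]) -> (R[i] -> R[i])) : Prop :=
  forall f, model_space theta f ->
    is_orth_proj (model_space theta) (phi \* f) (A f).

Definition is_truncated_Hankel (R : realType) (theta phi : R[i] -> R[i])
    (B : (R[i] -> R[i]) -> (R[i] -> R[i])) : Prop :=
  forall f, model_space theta f ->
    exists2 g, is_orth_proj (H2minus R) (phi \* f) g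
             & is_orth_proj (model_space theta) (Jop g) (B f).

Definition truncated_Toeplitz (R : realType) (theta : R[i] -> R[i]) :
    set ((R[i] -> R[i]) -> (R[i] -> R[i])) :=
  [set A | exists2 phi, Linfty R phi & is_truncated_Toeplitz theta phi A].

Definition truncated_Hankel (R : realType) (theta : R[i] -> R[i]) :
    set ((R[i] -> R[i]) -> (R[i] -> R[i])) :=
  [set B | exists2 phi, Linfty R phi & is_truncated_Hankel theta phi B].

Definition monom (R : realType) (k : nat) : R[i] -> R[i] := fun z => z ^+ k.
Arguments monom : clear implicits.

Definition op_matrix (R : realType) (n : nat)
    (A : (R[i] -> R[i]) -> (R[i] -> R[i])) : 'M[R[i]]_n :=
  \matrix_(i < n, j < n) inner_prod (A (monom R j)) (monom R i).

(* The intersection is taken between sets of operators on the model space of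
   z^n; its elements are then identified with their matrices. *)
Definition TH_inter (R : realType) (n : nat) : set 'M[R[i]]_n :=
  [set op_matrix n A | A in
     truncated_Toeplitz (monom R n) `&` truncated_Hankel (monom R n)].
Arguments TH_inter : clear implicits.

Definition toeplitz_mx (T : Type) (n : nat) (M : 'M[T]_n) : Prop :=
  forall i j k l : 'I_n,
    (i%:Z - j%:Z = k%:Z - l%:Z)%R -> M i j = M k l.

Definition hankel_mx (T : Type) (n : nat) (M : 'M[T]_n) : Prop :=
  forall i j k l : 'I_n, (i + j = k + l)%N -> M i j = M k l.

Definition E_even (R : realType) (n : nat) : 'M[R[i]]_n :=
  \matrix_(i < n, j < n) (if odd (i + j) then 0 else 1).
Arguments E_even : clear implicits.

Definition E_odd (R : realType) (n : nat) : 'M[R[i]]_n :=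
  \matrix_(i < n, j < n) (if odd (i + j) then 1 else 0).
Arguments E_odd : clear implicits.

(* Main.v *)
Require Import Defs.
From HB Require Import structures.
From mathcomp Require Import all_boot all_order all_algebra.
From mathcomp Require Import complex.
From mathcomp Require Import all_classical all_reals all_analysis.
From mathcomp Require Import measurable_realfun zify ring lra.

(** The powers z^k, for k an integer, are orthonormal in L^2 of the circle
    ([inner_prod_zpow]), and everything is read off from Fourier coefficients.
    The model space of z^n consists of the polynomials of degree less than n,
    up to null functions ([model_expand]).

    If A is at once a truncated Toeplitz operator with symbol phi and a
    truncated Hankel operator with symbol psi, its (i, j) entry is the Fourier
    coefficient of phi at the frequency i - j ([Toeplitz_entry]) and also that
    of psi at the frequency - (i + j + 1) ([Hankel_entry]); hence the matrix is
    both Toeplitz and Hankel. The second formula rests on the invariance of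
    Lebesgue measure under t |-> 1 - t, which is the effect of the flip J on
    the parameter of the circle.

    In a matrix that is both Toeplitz and Hankel, an entry depends only on the
    parity of i + j ([Toeplitz_Hankel_parity]), so that the matrix is a
    combination of the two checkerboards.

    Conversely, every such combination is realized by an explicit operator,
    with trigonometric polynomials as symbols ([checkerboard_TH_inter]). There
    the projections must be shown to exist: since elements of the model space
    and of H^2 are known only through approximation by polynomials, this is
    where [model_expand] and Cauchy-Schwarz are used. *)

Set Implicit Arguments.
Unset Strict Implicit.
Unset Printing Implicit Defensive.

Import Order.TTheory GRing.Theory Num.Theory.
Import numFieldNormedType.Exports.

Local Open Scope classical_set_scope.
Local Open Scope ring_scope.

Local Notation Re := complex.Re.
Local Notation Im := complex.Im.

(** * Complex numbers and the parametrization of the circle *)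

Section Complex.
Variable R : realType.
Local Notation C := R[i].
Implicit Types (x y z c : C) (t : R).

Lemma complexReD x y : Re (x + y) = Re x + Re y. Proof. by case: x y => ? ? []. Qed.
Lemma complexImD x y : Im (x + y) = Im x + Im y. Proof. by case: x y => ? ? []. Qed.
Lemma complexReM x y : Re (x * y) = Re x * Re y - Im x * Im y.
Proof. by case: x y => ? ? []. Qed.
Lemma complexImM x y : Im (x * y) = Re x * Im y + Im x * Re y.
Proof. by case: x y => ? ? []. Qed.
Lemma complexReJ x : Re (conjc x) = Re x. Proof. by case: x. Qed.
Lemma complexImJ x : Im (conjc x) = - Im x. Proof. by case: x. Qed.

Lemma sqr_normcE z :
  ComplexField.Normc.normc z ^+ 2 = Re z ^+ 2 + Im z ^+ 2.
Proof. by case: z => a b /=; rewrite sqr_sqrtr ?addr_ge0 ?sqr_ge0. Qed.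

Lemma complex_normc_ge0 z : 0 <= ComplexField.Normc.normc z.
Proof. by case: z => a b /=; rewrite sqrtr_ge0. Qed.

Lemma circle_ptD (s t : R) : circle_pt (s + t) = circle_pt s * circle_pt t.
Proof.
rewrite /circle_pt mulrDr cosD sinD; apply/eqP; rewrite eq_complex /=.
by apply/andP; split; apply/eqP => //; rewrite addrC [_ * sin _]mulrC mulrC.
Qed.

Lemma circle_pt0 : circle_pt (0 : R) = 1.
Proof. by rewrite /circle_pt mulr0 cos0 sin0. Qed.

Lemma circle_pt1 : circle_pt (1 : R) = 1.
Proof. by rewrite /circle_pt mulr1 mulrC mulr_natr cos2pi sin2pi. Qed.

Lemma circle_ptJ t : conjc (circle_pt t) = circle_pt (- t).
Proof. by rewrite /circle_pt mulrN cosN sinN. Qed.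

Lemma circle_pt_neq0 t : circle_pt t != 0.
Proof.
apply/eqP => /(congr1 (fun z => circle_pt (- t) * z)).
by rewrite -circle_ptD addNr circle_pt0 mulr0 => /eqP; rewrite oner_eq0.
Qed.

Lemma circle_ptV t : (circle_pt t)^-1 = circle_pt (- t).
Proof.
apply: (mulfI (circle_pt_neq0 t)).
by rewrite mulfV ?circle_pt_neq0 // -circle_ptD subrr circle_pt0.
Qed.

Lemma circle_pt_expn t (n : nat) : circle_pt t ^+ n = circle_pt (n%:R * t).
Proof.
elim: n => [|n IH]; first by rewrite mul0r circle_pt0 expr0.
by rewrite exprS IH -circle_ptD -natr1 mulrDl mul1r addrC.
Qed.

Lemma circle_ptX t (k : int) : circle_pt t ^ k = circle_pt (k%:~R * t).
Proof.
case: k => n; first exact: circle_pt_expn.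
by rewrite NegzE -invr_expz -exprnP circle_pt_expn circle_ptV mulrNz mulNr.
Qed.

Lemma circle_ptXJ t (k : int) : conjc (circle_pt t ^ k) = circle_pt t ^ (- k).
Proof. by rewrite !circle_ptX circle_ptJ mulrNz mulNr. Qed.

Lemma normc_circle_pt t : ComplexField.Normc.normc (circle_pt t) = 1.
Proof. by rewrite /= cos2Dsin2 sqrtr1. Qed.

Lemma circle_pt_onem t : circle_pt (1 - t) = conjc (circle_pt t).
Proof. by rewrite circle_ptD circle_pt1 mul1r circle_ptJ. Qed.

Lemma continuous_circle_pt :
  continuous (fun t => Re (circle_pt t)) /\ continuous (fun t => Im (circle_pt t)).
Proof.
split=> t /=.
  apply: continuous_comp; last exact: continuous_cos.
  exact: mulrl_continuous.
apply: continuous_comp; last exact: continuous_sin.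
exact: mulrl_continuous.
Qed.

End Complex.

(** * Integration over the unit interval *)

Section Integrals.
Variable R : realType.
Local Notation mu := (@lebesgue_measure R).
Local Notation I := (`[0, 1]%classic : set R).

Lemma measurable_unit_itv : measurable (I : set (measurableTypeR R)).
Proof. exact: measurable_itv. Qed.
Local Hint Resolve measurable_unit_itv : core.

Lemma lebesgue_unit_itv : mu I = 1%E.
Proof. by rewrite lebesgue_measure_itv /= lte_fin ltr01 oppr0 adde0. Qed.

(** Only functions with an antiderivative on the whole line are integrated
    below, so the one-sided boundary conditions of the fundamental theorem
    reduce to continuity. *)
Lemma FTC2_everywhere (f F : R -> R) : continuous f ->
  (forall x, is_derive x (1 : R) F (f x)) ->
  \int[mu]_(x in I) f x = F 1 - F 0.
Proof.
move=> cf dF.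
have cF : continuous F.
  move=> x; apply/differentiable_continuous/derivable1_diffP.
  by have := dF x; case.
rewrite /Rintegral (@continuous_FTC2 _ f F) //.
- exact: continuous_subspaceT.
- split.
  + by move=> x _; have := dF x; case.
  + exact/cvg_at_right_filter/cF.
  + exact/cvg_at_left_filter/cF.
- move=> x _; rewrite derive1E; have := dF x.
  by move=> dFx; rewrite derive_val.
Qed.

Lemma Re_int_circle_ptX (k : int) : k != 0 ->
  \int[mu]_(t in I) Re (circle_pt (k%:~R * t)) = 0.
Proof.
move=> k0; pose a : R := 2 * pi * k%:~R.
have a0 : a != 0 by rewrite !mulf_neq0 ?pnatr_eq0 ?intr_eq0 // gt_eqF // pi_gt0.
have aE t : Re (circle_pt (k%:~R * t)) = cos (a * t) by rewrite /a -mulrA.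
under eq_Rintegral do rewrite aE.
apply: etrans (FTC2_everywhere (F := fun t => a^-1 * sin (a * t)) _ _) _.
- move=> t; apply: continuous_comp; last exact: continuous_cos.
  exact: mulrl_continuous.
- move=> x; apply: is_derive_eq.
  by rewrite /GRing.scale /= mulr1; field.
- have -> : sin (a * 1) = Im (circle_pt (k%:~R * 1 : R)) by rewrite /= /a !mulr1.
  by rewrite -circle_ptX circle_pt1 exp1rz !mulr0 sin0 mulr0 subrr.
Qed.

Lemma Im_int_circle_ptX (k : int) :
  \int[mu]_(t in I) Im (circle_pt (k%:~R * t)) = 0.
Proof.
have [->|k0] := eqVneq k 0.
  under eq_Rintegral do rewrite mul0r circle_pt0.
  by rewrite Rintegral_cst // mul0r.
pose a : R := 2 * pi * k%:~R.
have a0 : a != 0 by rewrite !mulf_neq0 ?pnatr_eq0 ?intr_eq0 // gt_eqF // pi_gt0.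
have aE t : Im (circle_pt (k%:~R * t)) = sin (a * t) by rewrite /a -mulrA.
under eq_Rintegral do rewrite aE.
apply: etrans (FTC2_everywhere (F := fun t => - a^-1 * cos (a * t)) _ _) _.
- move=> t; apply: continuous_comp; last exact: continuous_sin.
  exact: mulrl_continuous.
- move=> x; apply: is_derive_eq.
  by rewrite /GRing.scale /= mulr1; field.
- have -> : cos (a * 1) = Re (circle_pt (k%:~R * 1 : R)) by rewrite /= /a !mulr1.
  by rewrite -circle_ptX circle_pt1 exp1rz mulr0 cos0 subrr.
Qed.

Lemma measurable_onem :
  measurable_fun [set: measurableTypeR R] (fun t : R => 1 - t : measurableTypeR R).
Proof.
apply: continuous_measurable_fun => t.
by apply: continuousB; [exact: cst_continuous | exact: cvg_id].
Qed.

(** Lebesgue measure is determined by its values on the intervals ]a, b], and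
    the reflection sends such an interval to one of the same length. *)
Lemma lebesgue_measure_onem (A : set R) : measurable A ->
  pushforward mu (fun t => 1 - t : measurableTypeR R) A = mu A.
Proof.
move=> mA; apply/esym/lebesgue_measure_unique => //=.
  exact: measurable_onem.
move=> _ _ [[a b] _ <-]; rewrite /pushforward.
have -> : (fun t : R => 1 - t) @^-1` `]a, b] = `[1 - b, 1 - a[%classic.
  apply/seteqP; split=> t /=; rewrite !in_itv /= => /andP[? ?].
    by apply/andP; split; lra.
  by apply/andP; split; lra.
rewrite !lebesgue_measure_itv /= !lte_fin.
have -> : (1 - b < 1 - a) = (a < b) by apply/idP/idP => ?; lra.
by case: ifP => // _; rewrite -!EFinD; congr EFin; ring.
Qed.

Lemma preimage_onem : (fun t : R => 1 - t) @^-1` I = I.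
Proof.
by apply/seteqP; split=> t /=; rewrite !in_itv /= => /andP[? ?];
  apply/andP; split; lra.
Qed.

(** The flip J turns into the substitution t := 1 - t of the parameter. The
    functions involved are merely integrable, so the substitution rules for
    continuous integrands do not apply; the integral is transported along the
    pushforward of the measure instead. The transport lemmas ask for
    measurability on the whole line, hence the extension of f by 0 outside the
    unit interval. *)
Lemma integrable_onem (f : R -> R) : mu.-integrable I (EFin \o f) ->
  mu.-integrable I (EFin \o (fun t => f (1 - t))) /\
  \int[mu]_(t in I) f (1 - t) = \int[mu]_(t in I) f t.
Proof.
move=> intf0; have intf :=
  (integrable_mkcond (mu := mu) (EFin \o f) (measurable_itv `[0%R, 1%R])).1 intf0.
pose T := measurableTypeR R.
pose phi := (fun t => 1 - t) : T -> T.
have phiK t : phi (phi t) = t by rewrite /phi; ring.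
pose g : T -> \bar R := (EFin \o f) \_ I.
have mg : measurable_fun [set: T] g := measurable_int _ intf.
have mphi : measurable_fun [set: T] phi := measurable_onem.
have mgphi : measurable_fun [set: T] (g \o phi) by exact: measurableT_comp.
have intg2 : mu.-integrable (phi @^-1` [set: T]) ((g \o phi) \o phi).
  rewrite preimage_setT; congr (mu.-integrable _ _) : intf.
  by apply/funext => t /=; rewrite phiK.
have int1 : mu.-integrable [set: T] (g \o phi).
  have /integrableP[? lt] := integrable_pushforward mphi mgphi intg2 measurableT.
  apply/integrableP; split => //; apply: le_lt_trans lt.
  rewrite le_eqVlt; apply/orP; left; apply/eqP.
  by apply: eq_measure_integral => A mA _; exact/esym/lebesgue_measure_onem.
have gphiE : g \o phi = (EFin \o (fun t => f (1 - t))) \_ I.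
  apply/funext => t; rewrite /g /= !patchE.
  have -> // : (phi t \in I) = (t \in I).
  by rewrite -[in RHS]preimage_onem; apply/idP/idP; rewrite !inE.
split.
  apply: (integrable_mkcond (mu := mu) _ (measurable_itv `[0%R, 1%R])).2.
  by rewrite -gphiE.
rewrite /Rintegral; congr fine.
rewrite [LHS]integral_mkcond [RHS]integral_mkcond -gphiE -/g.
have intg : mu.-integrable (phi @^-1` [set: T]) (g \o phi) by rewrite preimage_setT.
have := integral_pushforward mphi mg intg measurableT.
rewrite preimage_setT => <-.
by apply: eq_measure_integral => A mA _; exact: lebesgue_measure_onem.
Qed.

End Integrals.

Arguments measurable_unit_itv {R}.

(** * Integration over the circle *)

Section CircleIntegral.
Variable R : realType.
Local Notation C := R[i].
Local Notation mu := (@lebesgue_measure R).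
Local Notation I := (`[0, 1]%classic : set R).
Implicit Types (f g h : C -> C) (c : C) (k : int).

Local Hint Resolve measurable_unit_itv : core.

(** Integrability of the real and imaginary parts makes the integral complex-
    linear; without it, the integral takes default values. *)
Definition circle_integrable f : Prop :=
  mu.-integrable I (EFin \o (fun t => Re (f (circle_pt t)))) /\
  mu.-integrable I (EFin \o (fun t => Im (f (circle_pt t)))).

Lemma integrable_lin2 (f g : R -> R) (a b : R) :
  mu.-integrable I (EFin \o f) -> mu.-integrable I (EFin \o g) ->
  mu.-integrable I (EFin \o (fun t => a * f t + b * g t)) /\
  \int[mu]_(t in I) (a * f t + b * g t) =
  a * \int[mu]_(t in I) f t + b * \int[mu]_(t in I) g t.
Proof.
move=> intf intg.
have intaf : mu.-integrable I (EFin \o (fun t => a * f t)).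
  exact: (@integrableZl _ _ _ mu I measurable_unit_itv a (EFin \o f)).
have intbg : mu.-integrable I (EFin \o (fun t => b * g t)).
  exact: (@integrableZl _ _ _ mu I measurable_unit_itv b (EFin \o g)).
split; first exact: (integrableD measurable_unit_itv intaf intbg).
by rewrite RintegralD // !RintegralZl.
Qed.

Lemma circle_int_eq f g :
  (forall t, f (circle_pt t) = g (circle_pt t)) -> circle_int f = circle_int g.
Proof. by move=> fg; congr Complex; apply: eq_Rintegral => t _; rewrite fg. Qed.

Lemma circle_intD f g : circle_integrable f -> circle_integrable g ->
  circle_int (f \+ g) = circle_int f + circle_int g.
Proof.
move=> [f1 f2] [g1 g2]; rewrite {1}/circle_int.
under eq_Rintegral do rewrite /= complexReD.
under [X in Complex _ X]eq_Rintegral do rewrite /= complexImD.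
by rewrite !RintegralD.
Qed.

Lemma circle_intZ c f : circle_integrable f ->
  circle_int (fun z => c * f z) = c * circle_int f.
Proof.
move=> [f1 f2]; rewrite {1}/circle_int.
under eq_Rintegral do rewrite complexReM -mulNr.
under [X in Complex _ X]eq_Rintegral do rewrite complexImM.
rewrite (integrable_lin2 (Re c) (- Im c) f1 f2).2.
rewrite (integrable_lin2 (Re c) (Im c) f2 f1).2.
by apply/eqP; rewrite eq_complex complexReM complexImM /= mulNr !eqxx.
Qed.

Lemma circle_intJ f : circle_integrable f ->
  circle_int (fun z => conjc (f z)) = conjc (circle_int f).
Proof.
move=> [f1 f2]; rewrite /circle_int /=.
under eq_Rintegral do rewrite complexReJ.
under [X in Complex _ X]eq_Rintegral do rewrite complexImJ -mulN1r.
by rewrite RintegralZl // mulN1r.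
Qed.

Lemma circle_int0 : circle_int (fun _ => 0 : C) = 0.
Proof. by rewrite /circle_int /= Rintegral_cst // mul0r. Qed.

(** Orthonormality of the powers of z in its integral form. Negative powers of
    z stand for powers of its conjugate: both agree on the circle. *)
Lemma circle_int_zpow k : circle_int (fun z : C => z ^ k) = (k == 0)%:R.
Proof.
rewrite /circle_int.
under eq_Rintegral do rewrite circle_ptX.
under [X in Complex _ X]eq_Rintegral do rewrite circle_ptX.
rewrite Im_int_circle_ptX.
have [->|k0] := eqVneq k 0; last by rewrite Re_int_circle_ptX.
under eq_Rintegral do rewrite mul0r circle_pt0.
rewrite Rintegral_cst // mul1r.
by rewrite [X in fine X]lebesgue_unit_itv.
Qed.

Lemma circle_int_reflect f : circle_integrable f ->
  circle_int (fun z => f (conjc z)) = circle_int f.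
Proof.
move=> [f1 f2]; rewrite /circle_int.
under eq_Rintegral do rewrite -circle_pt_onem.
under [X in Complex _ X]eq_Rintegral do rewrite -circle_pt_onem.
by rewrite (integrable_onem f1).2 (integrable_onem f2).2.
Qed.

(** * Measurable, bounded and square-integrable functions on the circle *)

Lemma circle_measurableD f g : circle_measurable f -> circle_measurable g ->
  circle_measurable (f \+ g).
Proof.
move=> [f1 f2] [g1 g2]; split.
  rewrite (_ : (fun t : R => _) =
    (fun t => Re (f (circle_pt t))) \+ (fun t => Re (g (circle_pt t)))).
    exact: measurable_funD.
  by apply/funext => t /=; rewrite complexReD.
rewrite (_ : (fun t : R => _) =
    (fun t => Im (f (circle_pt t))) \+ (fun t => Im (g (circle_pt t)))).
  exact: measurable_funD.
by apply/funext => t /=; rewrite complexImD.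
Qed.

Lemma circle_measurableM f g : circle_measurable f -> circle_measurable g ->
  circle_measurable (f \* g).
Proof.
move=> [f1 f2] [g1 g2]; split.
  rewrite (_ : (fun t : R => _) =
    ((fun t => Re (f (circle_pt t))) \* (fun t => Re (g (circle_pt t)))) \-
    ((fun t => Im (f (circle_pt t))) \* (fun t => Im (g (circle_pt t))))).
    by apply: measurable_funB; exact: measurable_funM.
  by apply/funext => t /=; rewrite complexReM.
rewrite (_ : (fun t : R => _) =
    ((fun t => Re (f (circle_pt t))) \* (fun t => Im (g (circle_pt t)))) \+
    ((fun t => Im (f (circle_pt t))) \* (fun t => Re (g (circle_pt t))))).
  by apply: measurable_funD; exact: measurable_funM.
by apply/funext => t /=; rewrite complexImM.
Qed.

Lemma circle_measurableJ f : circle_measurable f ->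
  circle_measurable (fun z => conjc (f z)).
Proof.
move=> [f1 f2]; split.
  by move: f1; congr (measurable_fun _ _); apply/funext => t; rewrite complexReJ.
have := measurable_funN f2; congr (measurable_fun _ _).
by apply/funext => t; rewrite complexImJ.
Qed.

Lemma circle_measurable_cst c : circle_measurable (fun _ => c).
Proof. by split; exact: measurable_cst. Qed.

Lemma circle_measurable_zpow k : circle_measurable (fun z : C => z ^ k).
Proof.
have [cRe cIm] := continuous_circle_pt R.
have cscale : continuous (fun t : R => k%:~R * t) by exact: mulrl_continuous.
have mscale : measurable_fun I (fun t : R => k%:~R * t).
  have m0 := continuous_measurable_fun cscale.
  exact: measurable_funTS m0.
have mRe := continuous_measurable_fun cRe.
have mIm := continuous_measurable_fun cIm.
split; [have := measurableT_comp mRe mscale | have := measurableT_comp mIm mscale];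
  by congr (measurable_fun _ _); apply/funext => t; rewrite circle_ptX.
Qed.

Lemma measurable_sqr_norm f : circle_measurable f ->
  measurable_fun I (fun t => ComplexField.Normc.normc (f (circle_pt t)) ^+ 2).
Proof.
move=> [m1 m2].
rewrite (_ : (fun t : R => _) = (fun t => Re (f (circle_pt t)) ^+ 2) \+
    (fun t => Im (f (circle_pt t)) ^+ 2)).
  by apply: measurable_funD; exact: measurable_funX.
by apply/funext => t /=; rewrite sqr_normcE.
Qed.

Lemma integrable_sqr_norm f : L2 R f -> mu.-integrable I
  (EFin \o (fun t => Re (f (circle_pt t)) ^+ 2 + Im (f (circle_pt t)) ^+ 2)).
Proof.
move=> [_]; congr (mu.-integrable _ _).
by apply/funext => t; rewrite sqr_normcE.
Qed.

Lemma integrable_dominated (u b : R -> R) : measurable_fun I u ->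
  mu.-integrable I (EFin \o b) -> (forall t, `|u t| <= b t) ->
  mu.-integrable I (EFin \o u).
Proof.
move=> mu_ ib ub; apply: le_integrable ib => //.
  exact/measurable_EFinP.
by move=> t _ /=; rewrite lee_fin (le_trans (ub t)) // ler_norm.
Qed.

(** The factors 1 give the bound the shape of integrable_lin2. *)
Lemma norm_dot2_le (a b c d : R) :
  `|a * c + b * d| <= 1 * (a ^+ 2 + b ^+ 2) + 1 * (c ^+ 2 + d ^+ 2).
Proof.
have := (sqr_ge0 (a - c), sqr_ge0 (a + c), sqr_ge0 (b - d), sqr_ge0 (b + d)).
by move=> [[[? ?] ?] ?]; rewrite ler_norml; apply/andP; split; nra.
Qed.

Lemma L2_mulJ f g : L2 R f -> L2 R g ->
  circle_integrable (fun z => f z * conjc (g z)).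
Proof.
move=> L2f L2g.
have [m1 m2] := circle_measurableM L2f.1 (circle_measurableJ L2g.1).
have [ib _] := integrable_lin2 1 1 (integrable_sqr_norm L2f) (integrable_sqr_norm L2g).
split; apply: (integrable_dominated _ ib) => // t.
  by rewrite complexReM complexReJ complexImJ mulrN opprK; exact: norm_dot2_le.
rewrite complexImM complexReJ complexImJ; apply: le_trans (norm_dot2_le _ _ _ _) _.
by rewrite sqrrN [Im (g _) ^+ 2 + _]addrC.
Qed.

Lemma L2D f g : L2 R f -> L2 R g -> L2 R (f \+ g).
Proof.
move=> L2f L2g; have mfg := circle_measurableD L2f.1 L2g.1; split => //.
have [ib _] := integrable_lin2 2 2 (integrable_sqr_norm L2f) (integrable_sqr_norm L2g).
apply: (integrable_dominated _ ib).
  exact: measurable_sqr_norm.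
move=> t; rewrite sqr_normcE /= complexReD complexImD ger0_norm ?addr_ge0 ?sqr_ge0 //.
have := (sqr_ge0 (Re (f (circle_pt t)) - Re (g (circle_pt t))),
         sqr_ge0 (Im (f (circle_pt t)) - Im (g (circle_pt t)))).
by move=> [? ?]; nra.
Qed.

Lemma LinftyD f g : Linfty R f -> Linfty R g -> Linfty R (f \+ g).
Proof.
move=> [mf [M1 h1]] [mg [M2 h2]]; split; first exact: circle_measurableD.
exists (M1 + M2).
apply: (@filterS2 _ _ (ae_filter_ringOfSetsType mu) _ _ _ _ h1 h2) => t {}h1 {}h2 ht /=.
by rewrite (le_trans (le_normcD _ _)) // lerD ?h1 ?h2.
Qed.

Lemma LinftyM f g : Linfty R f -> Linfty R g -> Linfty R (f \* g).
Proof.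
move=> [mf [M1 h1]] [mg [M2 h2]]; split; first exact: circle_measurableM.
exists (M1 * M2).
apply: (@filterS2 _ _ (ae_filter_ringOfSetsType mu) _ _ _ _ h1 h2) => t {}h1 {}h2 ht /=.
by rewrite ComplexField.Normc.normcM ler_pM ?h1 ?h2 ?complex_normc_ge0 //.
Qed.

Lemma LinftyJ f : Linfty R f -> Linfty R (fun z => conjc (f z)).
Proof.
move=> [mf [M h]]; split; first exact: circle_measurableJ.
exists M; apply: (@filterS _ _ (ae_filter_ringOfSetsType mu) _ _ _ h) => t + H => /(_ H).
by case: (f _) => a b /=; rewrite sqrrN.
Qed.

Lemma Linfty_cst c : Linfty R (fun _ => c).
Proof.
split; first exact: circle_measurable_cst.
by exists (ComplexField.Normc.normc c); apply: aeW.
Qed.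

Lemma Linfty_zpow k : Linfty R (fun z : C => z ^ k).
Proof.
split; first exact: circle_measurable_zpow.
by exists 1; apply: aeW => t _; rewrite circle_ptX normc_circle_pt.
Qed.

Lemma LinftyZ c f : Linfty R f -> Linfty R (fun z => c * f z).
Proof. by move=> Lf; have := LinftyM (Linfty_cst c) Lf. Qed.

(** The essential bound of phi holds only outside a null set, which is removed
    from the domain before the squares are compared. *)
Lemma L2M phi f : Linfty R phi -> L2 R f -> L2 R (phi \* f).
Proof.
move=> [mphi [M hM]] L2f.
have mpf := circle_measurableM mphi L2f.1; split => //.
case: hM => N [mN muN0 hN].
have mF : measurable_fun I (fun t : R =>
    (ComplexField.Normc.normc ((phi \* f) (circle_pt t)) ^+ 2)%:E).
  by apply/measurable_EFinP; exact: measurable_sqr_norm.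
apply/(negligible_integrable mN measurable_unit_itv mF muN0).
have [ib _] := integrable_lin2 (M ^+ 2) 0
  (integrable_sqr_norm L2f) (integrable_sqr_norm L2f).
have ib' : mu.-integrable (I `\` N) (EFin \o (fun t : R =>
  M ^+ 2 * (Re (f (circle_pt t)) ^+ 2 + Im (f (circle_pt t)) ^+ 2))).
  apply: (@integrableS _ _ _ mu I) => //; first exact: measurableD.
  by move: ib; congr (mu.-integrable _ _); apply/funext => t /=; rewrite mul0r addr0.
apply: le_integrable ib' => //; first exact: measurableD.
  exact: measurable_funS mF.
move=> t [It Nt] /=.
have {}hN : ComplexField.Normc.normc (phi (circle_pt t)) <= M.
  apply: contrapT => h; apply: Nt; apply: hN => /= H; apply: h.
  by apply: H; move: It; rewrite /= in_itv.
have M0 : 0 <= M := le_trans (complex_normc_ge0 _) hN.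
rewrite lee_fin ComplexField.Normc.normcM exprMn -sqr_normcE.
rewrite !ger0_norm ?mulr_ge0 ?exprn_ge0 ?complex_normc_ge0 //.
by rewrite ler_wpM2r ?exprn_ge0 ?complex_normc_ge0 // lerXn2r // nnegrE complex_normc_ge0.
Qed.

Lemma L2_cst c : L2 R (fun _ => c).
Proof.
split; first exact: circle_measurable_cst.
apply/integrableP; split; first exact: measurable_cst.
by rewrite integral_cst // [X in (_ * X)%E]lebesgue_unit_itv mule1 ltry //.
Qed.

Lemma Linfty_L2 f : Linfty R f -> L2 R f.
Proof.
move=> Lf; have := L2M Lf (L2_cst 1); congr (L2 R _).
by apply/funext => z /=; rewrite mulr1.
Qed.

End CircleIntegral.

(** * The inner product of L^2 *)

Section InnerProduct.
Variable R : realType.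
Local Notation C := R[i].
Local Notation mu := (@lebesgue_measure R).
Local Notation I := (`[0, 1]%classic : set R).
Implicit Types (f g h u : C -> C) (c : C) (k l : int).

Local Hint Resolve measurable_unit_itv : core.

Lemma fun_sum_ind (P : (C -> C) -> Prop) : P (fun _ => 0) ->
  (forall f g, P f -> P g -> P (f \+ g)) ->
  forall N (F : 'I_N -> C -> C), (forall i, P (F i)) ->
  P (fun z => \sum_(i < N) F i z).
Proof.
move=> P0 PD; elim=> [|N IH] F PF.
  by move: P0; congr P; apply/funext => z; rewrite big_ord0.
have := PD _ _ (IH (fun i => F (widen_ord (leqnSn N) i)) (fun i => PF _)) (PF ord_max).
by congr P; apply/funext => z; rewrite big_ord_recr.
Qed.

Lemma L2Z c f : L2 R f -> L2 R (fun z => c * f z).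
Proof. by move=> L2f; have := L2M (Linfty_cst c) L2f. Qed.

Lemma L2B f g : L2 R f -> L2 R g -> L2 R (f \- g).
Proof.
move=> L2f L2g; have := L2D L2f (L2Z (-1) L2g); congr (L2 R _).
by apply/funext => z /=; rewrite mulN1r.
Qed.

Lemma L2_sum N (F : 'I_N -> C -> C) : (forall i, L2 R (F i)) ->
  L2 R (fun z => \sum_(i < N) F i z).
Proof. by apply: fun_sum_ind; [exact: L2_cst | exact: L2D]. Qed.

Lemma Linfty_sum N (F : 'I_N -> C -> C) : (forall i, Linfty R (F i)) ->
  Linfty R (fun z => \sum_(i < N) F i z).
Proof. by apply: fun_sum_ind; [exact: Linfty_cst | exact: LinftyD]. Qed.

Lemma L2_zpow k : L2 R (fun z => z ^ k).
Proof. exact/Linfty_L2/Linfty_zpow. Qed.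

Lemma inner_prod_eq f f' g g' :
  (forall t, f (circle_pt t) = f' (circle_pt t)) ->
  (forall t, g (circle_pt t) = g' (circle_pt t)) ->
  inner_prod f g = inner_prod f' g'.
Proof. by move=> ff gg; apply: circle_int_eq => t; rewrite ff gg. Qed.

Lemma inner_prodJ f g : L2 R f -> L2 R g ->
  inner_prod g f = conjc (inner_prod f g).
Proof.
move=> L2f L2g; rewrite -circle_intJ; last exact: L2_mulJ.
by apply: circle_int_eq => t; rewrite rmorphM /= conjcK mulrC.
Qed.

Lemma inner_prodDl f g h : L2 R f -> L2 R g -> L2 R h ->
  inner_prod (f \+ g) h = inner_prod f h + inner_prod g h.
Proof.
move=> L2f L2g L2h; rewrite -circle_intD; try exact: L2_mulJ.
by apply: circle_int_eq => t /=; rewrite mulrDl.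
Qed.

Lemma inner_prodZl c f h : L2 R f -> L2 R h ->
  inner_prod (fun z => c * f z) h = c * inner_prod f h.
Proof.
move=> L2f L2h; rewrite -circle_intZ; last exact: L2_mulJ.
by apply: circle_int_eq => t /=; rewrite mulrA.
Qed.

Lemma inner_prod0l h : inner_prod (fun _ => 0) h = 0.
Proof. by rewrite -[RHS]circle_int0; apply: circle_int_eq => t; rewrite mul0r. Qed.

Lemma inner_prodBl f g h : L2 R f -> L2 R g -> L2 R h ->
  inner_prod (f \- g) h = inner_prod f h - inner_prod g h.
Proof.
move=> L2f L2g L2h; rewrite -mulN1r -inner_prodZl // -inner_prodDl //; last exact: L2Z.
by apply: inner_prod_eq => // t /=; rewrite mulN1r.
Qed.

Lemma inner_prodBr f g h : L2 R f -> L2 R g -> L2 R h ->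
  inner_prod h (f \- g) = inner_prod h f - inner_prod h g.
Proof.
move=> L2f L2g L2h; rewrite (inner_prodJ (L2B L2f L2g) L2h) inner_prodBl //.
by rewrite (inner_prodJ L2f L2h) (inner_prodJ L2g L2h) rmorphB.
Qed.

Lemma inner_prodZr c f h : L2 R f -> L2 R h ->
  inner_prod h (fun z => c * f z) = conjc c * inner_prod h f.
Proof.
move=> L2f L2h; rewrite (inner_prodJ (L2Z c L2f) L2h) inner_prodZl //.
by rewrite (inner_prodJ L2f L2h) rmorphM.
Qed.

Lemma inner_prod_suml N (F : 'I_N -> C -> C) h : (forall i, L2 R (F i)) -> L2 R h ->
  inner_prod (fun z => \sum_(i < N) F i z) h = \sum_(i < N) inner_prod (F i) h.
Proof.
elim: N F => [|N IH] F L2F L2h.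
  rewrite big_ord0 -[RHS](inner_prod0l h).
  by apply: inner_prod_eq => // t; rewrite big_ord0.
rewrite big_ord_recr /= -(IH (fun i => F (widen_ord (leqnSn N) i))) //.
rewrite -inner_prodDl //; last exact: L2_sum.
by apply: inner_prod_eq => // t; rewrite big_ord_recr.
Qed.

Lemma inner_prod_lincomb_zpow N (a : 'I_N -> C) (e : 'I_N -> int) h : L2 R h ->
  inner_prod (fun z => \sum_(i < N) a i * z ^ e i) h =
  \sum_(i < N) a i * inner_prod (fun z => z ^ e i) h.
Proof.
move=> L2h; rewrite (inner_prod_suml (F := fun i z => a i * z ^ e i)) //.
  by apply: eq_bigr => i _; rewrite inner_prodZl //; exact: L2_zpow.
by move=> i; apply/L2Z/L2_zpow.
Qed.

Lemma Linfty_lincomb_zpow N (a : 'I_N -> C) (e : 'I_N -> int) :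
  Linfty R (fun z => \sum_(i < N) a i * z ^ e i).
Proof.
by apply: (Linfty_sum (F := fun i z => a i * z ^ e i)) => i; apply/LinftyZ/Linfty_zpow.
Qed.

Lemma L2_lincomb_zpow N (a : 'I_N -> C) (e : 'I_N -> int) :
  L2 R (fun z => \sum_(i < N) a i * z ^ e i).
Proof. exact/Linfty_L2/Linfty_lincomb_zpow. Qed.

Lemma inner_prod_zpow k l :
  inner_prod (fun z : C => z ^ k) (fun z => z ^ l) = (k == l)%:R.
Proof.
rewrite -subr_eq0 -circle_int_zpow; apply: circle_int_eq => t.
by rewrite circle_ptXJ -expfzDr ?circle_pt_neq0.
Qed.

Lemma inner_prodMl phi f g :
  inner_prod (phi \* f) g = inner_prod f (fun z => conjc (phi z) * g z).
Proof.
apply: circle_int_eq => t /=; rewrite rmorphM /= conjcK; ring.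
Qed.

Lemma inner_prod_zpowMl k f l : inner_prod (fun z => z ^ k * f z) (fun z => z ^ l) =
  inner_prod f (fun z => z ^ (l - k)).
Proof.
apply: circle_int_eq => t; rewrite [LHS]mulrAC mulrC !circle_ptXJ opprB.
by rewrite expfzDr ?circle_pt_neq0.
Qed.

Lemma Re_inner_prod_ge0 f : 0 <= Re (inner_prod f f).
Proof.
apply: Rintegral_ge0 => t _; case: (f _) => a b /=.
by rewrite mulrN opprK addr_ge0 // -expr2 sqr_ge0.
Qed.

(** The optimal parameter is s = 1 / B; for B = 0 the polynomial is affine in
    s, and a large s forces q = 0. *)
Lemma quadratic_bound (q A B : R) : 0 <= q -> 0 <= A -> 0 <= B ->
  (forall s : R, 0 <= A - 2 * s * q + s ^+ 2 * q * B) -> q <= A * B.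
Proof.
move=> q0 A0 B0 H; have [B_eq0|Bn0] := eqVneq B 0.
  have [->|qn0] := eqVneq q 0; first by rewrite mulr_ge0.
  have := H ((A + 1) / (2 * q)); rewrite B_eq0 !mulr0 addr0.
  have -> : 2 * ((A + 1) / (2 * q)) * q = A + 1 by field.
  lra.
have {}B0 : 0 < B by rewrite lt_neqAle eq_sym Bn0.
have := H B^-1.
have -> : A - 2 * B^-1 * q + B^-1 ^+ 2 * q * B = A - q / B by field.
by rewrite subr_ge0 ler_pdivrMr.
Qed.

(** The squared norm of f - s <f, g> g is nonnegative for every real s, and it
    is the quadratic polynomial in s of the previous lemma. *)
Lemma Cauchy_Schwarz_L2 f g : L2 R f -> L2 R g ->
  ComplexField.Normc.normc (inner_prod f g) ^+ 2 <=
  Re (inner_prod f f) * Re (inner_prod g g).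
Proof.
move=> L2f L2g; apply: quadratic_bound;
  rewrite ?Re_inner_prod_ge0 ?exprn_ge0 ?complex_normc_ge0 //.
move=> s; set c := inner_prod f g; pose d := Complex s 0 * c.
have := Re_inner_prod_ge0 (f \- (fun z => d * g z)).
have L2dg : L2 R (fun z => d * g z) by exact: L2Z.
rewrite inner_prodBl ?inner_prodBr ?inner_prodZl ?inner_prodZr //; try exact: L2B.
rewrite (inner_prodJ L2f L2g) -/c sqr_normcE /d {L2dg d}.
case: c => x y; case: (inner_prod g g) => b1 b2; case: (inner_prod f f) => a1 a2 /=.
by congr (0 <= _); ring.
Qed.

Lemma inner_prod_null f u : L2 R f -> L2 R u -> inner_prod f f = 0 -> inner_prod f u = 0.
Proof.
move=> L2f L2u f0; have := Cauchy_Schwarz_L2 L2f L2u; rewrite f0 mul0r => le0.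
apply: ComplexField.Normc.eq0_normc; apply/eqP; rewrite -sqrf_eq0.
by rewrite eq_le le0 exprn_ge0 // complex_normc_ge0.
Qed.

(** * The Hardy space and its complement *)

Lemma hornerE_zpow (p : {poly C}) :
  horner p = fun z => \sum_(i < size p) p`_i * z ^ (i : nat).
Proof. by apply/funext => z; rewrite horner_coef. Qed.

Lemma H2_poly (p : {poly C}) : H2 R (horner p).
Proof.
split; first by rewrite hornerE_zpow; exact: (L2_lincomb_zpow _ (fun i => i : nat)).
move=> e e0; exists p; rewrite /L2norm.
rewrite (inner_prod_eq (f' := fun=> 0) (g' := fun=> 0)) => [|t /=|t /=]; try exact: subrr.
by rewrite inner_prod0l /= sqrtr0.
Qed.

Lemma H2_zpow (k : nat) : H2 R (fun z => z ^ k).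
Proof.
have := H2_poly 'X^k; congr (H2 R _).
by apply/funext => z; rewrite hornerXn.
Qed.

(** By Cauchy-Schwarz, <f, h> = <f, h - p> is as small as the distance from h
    to the polynomial p, and polynomials are dense in the Hardy space. *)
Lemma orthogonal_H2 f : L2 R f ->
  (forall k : nat, inner_prod f (fun z => z ^ k) = 0) ->
  forall h, H2 R h -> inner_prod f h = 0.
Proof.
move=> L2f f_orth h [L2h approx].
have fp (p : {poly C}) : inner_prod f (horner p) = 0.
  have L2p : L2 R (horner p) by case: (H2_poly p).
  rewrite inner_prodJ // hornerE_zpow.
  rewrite (inner_prod_lincomb_zpow _ (fun i => i : nat)) // big1 ?conjc0 // => i _.
  by rewrite inner_prodJ ?f_orth ?conjc0 ?mulr0 //; exact: L2_zpow.
apply: ComplexField.Normc.eq0_normc; apply/eqP; rewrite -sqrf_eq0.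
set q := _ ^+ 2; have q0 : 0 <= q by rewrite exprn_ge0 ?complex_normc_ge0.
have A0 := Re_inner_prod_ge0 f; set A := Re _ in A0.
apply: contraT => qn0; have {}q0 : 0 < q by rewrite lt_neqAle eq_sym qn0.
(* With q = |<f, h>|^2 and A = <f, f>, a polynomial at distance less than
   sqrt (q / (A + 1)) from h would give q <= A * q / (A + 1) < q. *)
have e0 : 0 < Num.sqrt (q / (A + 1)) by rewrite sqrtr_gt0 divr_gt0 // ltr_wpDl.
have [p] := approx _ e0.
rewrite /L2norm ltr_sqrt; last by rewrite divr_gt0 // ltr_wpDl.
have L2p : L2 R (horner p) by case: (H2_poly p).
have := Cauchy_Schwarz_L2 L2f (L2B L2h L2p).
rewrite inner_prodBr // fp subr0 -/q -/A => leq.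
rewrite ltr_pdivlMr ?ltr_wpDl // => lt_q.
suff : q < q by rewrite ltxx.
apply: le_lt_trans lt_q; apply: le_trans leq _.
by rewrite mulrC ler_wpM2l ?Re_inner_prod_ge0 // lerDl.
Qed.

(** Functions of H^2 have no negative frequencies. *)
Lemma H2minus_zpow k : k < 0 -> H2minus R (fun z => z ^ k).
Proof.
move=> k0; split; first exact: L2_zpow.
apply: orthogonal_H2 => [|l]; first exact: L2_zpow.
by rewrite inner_prod_zpow (_ : (_ == _) = false) //; apply/eqP => kl; rewrite kl in k0.
Qed.

Lemma zpow_orth_H2minus (k : nat) g : H2minus R g -> inner_prod (fun z => z ^ k) g = 0.
Proof.
move=> [L2g orth]; rewrite inner_prodJ ?orth ?conjc0 //; first exact: H2_zpow.
exact: L2_zpow.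
Qed.

(** * The model space of z^n *)

Lemma model_lincomb n (a : 'I_n -> C) :
  model_space (monom R n) (fun z => \sum_(i < n) a i * z ^ (i : nat)).
Proof.
split.
  have := H2_poly (\sum_(i < n) a i *: 'X^i); congr (H2 R _).
  apply/funext => z; rewrite horner_sum; apply: eq_bigr => i _.
  by rewrite hornerZ hornerXn.
move=> _ [h H2h <-].
have L2h := H2h.1.
have L2nh : L2 R (monom R n \* h) by apply: L2M => //; exact: (Linfty_zpow R n).
rewrite (inner_prod_lincomb_zpow _ (fun i => i : nat)) // big1 // => i _.
rewrite inner_prodJ //; last exact: L2_zpow.
have -> : inner_prod (monom R n \* h) (fun z => z ^ (i : nat)) = _ :=
  inner_prod_zpowMl n h i.
rewrite -inner_prodJ //; last exact: L2_zpow.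
rewrite (H2minus_zpow _).2 ?mulr0 //.
by rewrite subr_lt0 ltz_nat.
Qed.

Lemma model_zpow n (i : nat) : (i < n)%N ->
  model_space (monom R n) (fun z => z ^ i).
Proof.
move=> lt_in; have := model_lincomb (fun j : 'I_n => (j == Ordinal lt_in)%:R).
congr (model_space _ _); apply/funext => z.
rewrite (bigD1 (Ordinal lt_in)) //= eqxx mul1r big1 ?addr0 // => j /negbTE ->.
by rewrite mul0r.
Qed.

(** The function f - sum_j <f, z^j> z^j is orthogonal to every z^k with k < n
    by orthonormality, and to every z^k with k >= n because z^k = z^n z^(k -
    n); hence it is orthogonal to H^2, which contains it, and it is null. Thus
    f is, up to a null function, a polynomial of degree less than n, and the
    statement is the weak form of this expansion. *)
Lemma model_expand n f u : model_space (monom R n) f -> L2 R u ->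
  inner_prod f u =
  \sum_(j < n) inner_prod f (fun z => z ^ (j : nat)) * inner_prod (fun z => z ^ (j : nat)) u.
Proof.
move=> Kf L2u; have [H2f f_orth] := Kf; have L2f := H2f.1.
pose q : C -> C := fun z => \sum_(j < n) inner_prod f (fun z => z ^ (j : nat)) * z ^ (j : nat).
have Kq : model_space (monom R n) q := model_lincomb _.
have L2q : L2 R q by case: Kq => -[].
have qE v : L2 R v -> inner_prod q v = \sum_(j < n)
    inner_prod f (fun z => z ^ (j : nat)) * inner_prod (fun z => z ^ (j : nat)) v.
  by move=> L2v; exact: (inner_prod_lincomb_zpow _ (fun i => i : nat)).
have L2r : L2 R (f \- q) by exact: L2B.
have r_orth : forall h, H2 R h -> inner_prod (f \- q) h = 0.
  apply: orthogonal_H2 => // k; have L2k := L2_zpow k.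
  rewrite inner_prodBl // qE //; apply/eqP; rewrite subr_eq0; apply/eqP.
  under eq_bigr do rewrite inner_prod_zpow eqz_nat.
  have [lt_kn|le_nk] := ltnP k n.
    rewrite (bigD1 (Ordinal lt_kn)) //= eqxx mulr1 big1 ?addr0 // => j.
    by rewrite -val_eqE /= => /negbTE ->; rewrite mulr0.
  rewrite big1 => [|j _].
    rewrite -(f_orth (fun z => z ^+ n * z ^ (k - n)%N)).
      by apply: inner_prod_eq => // t; rewrite -exprD subnKC.
    by exists (fun z => z ^ (k - n)%N) => //; exact: H2_zpow.
  by rewrite (_ : (_ == _) = false) ?mulr0 // ltn_eqF // (leq_trans _ le_nk).
rewrite -qE //; apply/eqP; rewrite -subr_eq0 -inner_prodBl //; apply/eqP.
apply: inner_prod_null => //.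
by rewrite inner_prodBr // !r_orth ?subr0 //; case: Kq.
Qed.

Lemma orthogonal_model n g h : L2 R g ->
  (forall i : 'I_n, inner_prod g (fun z => z ^ (i : nat)) = 0) ->
  model_space (monom R n) h -> inner_prod g h = 0.
Proof.
move=> L2g g_orth Kh; have L2h := Kh.1.1.
rewrite inner_prodJ // (model_expand Kh L2g) big1 ?conjc0 // => i _.
by rewrite (inner_prodJ L2g (L2_zpow _)) g_orth conjc0 mulr0.
Qed.

(** This is how an entry of a compressed operator is read off from its symbol. *)
Lemma orth_proj_inner (S : set (C -> C)) f g h : is_orth_proj S f g ->
  S h -> L2 R f -> L2 R g -> L2 R h -> inner_prod g h = inner_prod f h.
Proof.
move=> [_ /(_ h)] + Sh L2f L2g L2h => /(_ Sh); rewrite inner_prodBl // => /eqP.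
by rewrite subr_eq0 => /eqP.
Qed.

(** * The flip J *)

(** The substitution is only available for integrable functions, so the
    measurability of g after reflection comes from the integrability of its
    real and imaginary parts: L^2 is contained in L^1 on the circle. *)
Lemma L2_reflect g : L2 R g -> L2 R (fun z => g (conjc z)).
Proof.
move=> L2g.
have [g1 g2] : circle_integrable g.
  have := L2_mulJ L2g (L2_cst 1); congr (circle_integrable _).
  by apply/funext => z; rewrite conjc1 mulr1.
have [r1 _] := integrable_onem g1; have [r2 _] := integrable_onem g2.
have [r3 _] := integrable_onem L2g.2.
split; last first.
  by move: r3; congr (mu.-integrable _ _); apply/funext => t /=; rewrite circle_pt_onem.
split.
  move/measurable_int : r1 => /measurable_EFinP; congr (measurable_fun _ _).
  by apply/funext => t; rewrite circle_pt_onem.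
move/measurable_int : r2 => /measurable_EFinP; congr (measurable_fun _ _).
by apply/funext => t; rewrite circle_pt_onem.
Qed.

Lemma L2_Jop g : L2 R g -> L2 R (Jop g).
Proof.
move=> L2g; apply: (@L2M _ (fun z => conjc z)); last exact: L2_reflect.
exact: (LinftyJ (Linfty_zpow R 1)).
Qed.

(** After the substitution of the conjugate of z for z, the factor conj z of J
    shifts the frequency by one: J maps z^(-(k + 1)) to z^k. *)
Lemma inner_prod_Jop g k : L2 R g ->
  inner_prod (Jop g) (fun z => z ^ k) = inner_prod g (fun z => z ^ (- (k + 1))).
Proof.
move=> L2g; have int := L2_mulJ L2g (L2_zpow (- (k + 1))).
rewrite /inner_prod -[RHS](circle_int_reflect int); apply: circle_int_eq => t.
rewrite /Jop [LHS]mulrAC mulrC; congr (_ * _).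
rewrite -rmorphM; congr conjc.
rewrite circle_ptJ -circle_ptV exprz_inv opprK addrC.
by rewrite -[X in X * _]expr1z -expfzDr ?circle_pt_neq0.
Qed.

End InnerProduct.

(** * Matrix entries as Fourier coefficients *)

Section Entries.
Variable R : realType.
Local Notation C := R[i].
Implicit Types (f g h u : C -> C) (c : C) (k l : int).

Lemma inner_prod_symbol phi k l :
  inner_prod (phi \* (fun z : C => z ^ k)) (fun z => z ^ l) =
  circle_int (fun z => phi z * z ^ (k - l)).
Proof.
apply: circle_int_eq => t /=.
by rewrite circle_ptXJ -mulrA -expfzDr ?circle_pt_neq0.
Qed.

Lemma sum_delta N (c : 'I_N -> C) (e : 'I_N -> int) l (k0 : 'I_N) :
  injective e -> e k0 = l -> \sum_(k < N) c k * (e k == l)%:R = c k0.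
Proof.
move=> inj_e <-; rewrite (bigD1 k0) //= eqxx mulr1 big1 ?addr0 // => k k_k0.
by rewrite (inj_eq inj_e) (negbTE k_k0) mulr0.
Qed.

(** Extraction of a Fourier coefficient of a trigonometric polynomial. *)
Lemma circle_int_trig N (c : 'I_N -> C) (e : 'I_N -> int) l (k0 : 'I_N) :
  injective e -> e k0 + l = 0 ->
  circle_int (fun z => (\sum_(k < N) c k * z ^ e k) * z ^ l) = c k0.
Proof.
move=> inj_e /eqP; rewrite addr_eq0 => /eqP ek0; rewrite -(sum_delta c inj_e ek0).
transitivity (inner_prod (fun z => \sum_(k < N) c k * z ^ e k) (fun z => z ^ (- l))).
  by apply: circle_int_eq => t; rewrite circle_ptXJ opprK.
rewrite inner_prod_lincomb_zpow; last exact: L2_zpow.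
by apply: eq_bigr => k _; rewrite inner_prod_zpow.
Qed.

(** The entry is the Fourier coefficient of phi at i - j: z^i lies in the
    model space, so the projection onto it is invisible in the inner product. *)
Lemma Toeplitz_entry n phi (A : (C -> C) -> (C -> C)) (i j : nat) :
  Linfty R phi -> is_truncated_Toeplitz (monom R n) phi A ->
  (i < n)%N -> (j < n)%N ->
  inner_prod (A (monom R j)) (monom R i) =
  circle_int (fun z => phi z * z ^ (j%:Z - i%:Z)).
Proof.
move=> Lphi TA lt_in lt_jn; rewrite -inner_prod_symbol.
have pA := TA _ (model_zpow R lt_jn).
by apply: (orth_proj_inner pA);
  [exact: model_zpow | exact/L2M/(L2_zpow R j) | case: pA => -[[]] | exact: (L2_zpow R i)].
Qed.

(** Both projections are invisible: the one onto the model space because it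
    contains z^i, and the one onto the complement of H^2 because, after J is
    moved to the other side, the inner product is taken against z^(-(i + 1)),
    which belongs to that complement. *)
Lemma Hankel_entry n psi (B : (C -> C) -> (C -> C)) (i j : nat) :
  Linfty R psi -> is_truncated_Hankel (monom R n) psi B ->
  (i < n)%N -> (j < n)%N ->
  inner_prod (B (monom R j)) (monom R i) =
  circle_int (fun z => psi z * z ^ (i + j + 1)%N).
Proof.
move=> Lpsi HB lt_in lt_jn.
have [g pg pB] := HB _ (model_zpow R lt_jn).
have L2g : L2 R g by case: pg => -[].
transitivity (inner_prod (Jop g) (fun z => z ^ i)).
  by apply: (orth_proj_inner pB);
    [exact: model_zpow | exact: L2_Jop | case: pB => -[[]] | exact: (L2_zpow R i)].
rewrite inner_prod_Jop //.
have -> : (i + j + 1)%N%:Z = j%:Z - (- (i%:Z + 1)) by rewrite opprK !PoszD; ring.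
rewrite -inner_prod_symbol; apply: (orth_proj_inner pg) => //.
- by apply: H2minus_zpow; rewrite oppr_lt0.
- exact/L2M/(L2_zpow R j).
- exact: L2_zpow.
Qed.

Lemma TH_inter_Toeplitz_Hankel n (M : 'M[C]_n) :
  TH_inter R n M -> toeplitz_mx M /\ hankel_mx M.
Proof.
move=> [A [[phi Lphi TA] [psi Lpsi HA]] <-]; split=> i j k l eq_ijkl; rewrite !mxE.
  rewrite !(Toeplitz_entry Lphi TA) //; congr circle_int; apply/funext => z.
  by rewrite -opprB eq_ijkl opprB.
by rewrite !(Hankel_entry Lpsi HA) // eq_ijkl.
Qed.

(** * Matrices that are both Toeplitz and Hankel *)

(** Moving along a diagonal changes i + j by 2, and moving along an
    antidiagonal keeps it; with both moves every entry is brought down to (0,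
    0) or (0, 1), where i + j has the parity of the initial entry. *)
Lemma Toeplitz_Hankel_parity (T : Type) n (M : 'M[T]_n.+2) :
  toeplitz_mx M -> hankel_mx M ->
  forall i j, M i j = M ord0 (if odd (i + j) then lift ord0 ord0 else ord0).
Proof.
move=> TM HM i j; have [s] := ubnP (i + j).
elim: s i j => // s IH [i lt_i] [j lt_j]; rewrite /= ltnS => le_s.
case: i => [|i] in lt_i le_s *.
  case: j => [|[|j]] in lt_j le_s *; rewrite /=.
  - by congr (M _ _); apply: val_inj.
  - by congr (M _ _); apply: val_inj.
  have lt_j0 : (j < n.+2)%N by lia.
  have lt_j1 : (j.+1 < n.+2)%N by lia.
  rewrite (HM _ _ (lift ord0 ord0) (Ordinal lt_j1)) //.
  rewrite (TM _ _ ord0 (Ordinal lt_j0)) /=; last by rewrite /bump /=; lia.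
  by rewrite IH /= ?negbK //; lia.
case: j => [|j] in lt_j le_s *.
  case: i => [|i] in lt_i le_s *.
    by rewrite addn0 /=; apply: HM.
  have lt_i0 : (i < n.+2)%N by lia.
  have lt_i1 : (i.+1 < n.+2)%N by lia.
  rewrite (HM _ _ (Ordinal lt_i1) (lift ord0 ord0)) /=; last by rewrite /bump /=; lia.
  rewrite (TM _ _ (Ordinal lt_i0) ord0) /=; last by rewrite /bump /=; lia.
  by rewrite IH /= ?addn0 ?negbK //; lia.
have lt_i0 : (i < n.+2)%N by lia.
have lt_j0 : (j < n.+2)%N by lia.
rewrite (TM _ _ (Ordinal lt_i0) (Ordinal lt_j0)) /=; last by lia.
rewrite IH /=; last by lia.
by rewrite addnS /= negbK.
Qed.

Definition checkerboard n (a b : C) : 'M[C]_n :=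
  \matrix_(i, j) (if odd (i + j) then b else a).

Lemma checkerboardE n a b :
  checkerboard n a b = a *: E_even R n + b *: E_odd R n.
Proof.
by apply/matrixP => i j; rewrite !mxE; case: ifP => _;
  rewrite ?mulr1 ?mulr0 ?addr0 ?add0r.
Qed.

Lemma span_checkerboard n (M : 'M[C]_n) :
  M \in <<[:: E_even R n; E_odd R n]>>%VS <-> exists a b, M = checkerboard n a b.
Proof.
rewrite span_cons span_seq1; split.
  move=> /memv_addP[_ /vlineP[a ->] [_ /vlineP[b ->] ->]].
  by exists a, b; rewrite checkerboardE.
by move=> [a [b ->]]; rewrite checkerboardE memv_add ?memvZ ?memv_line.
Qed.

(** * Realization of checkerboards by truncated operators *)

(** The operator with matrix M in the basis of the powers of z, extended to
    all functions through their first n Fourier coefficients. *)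
Definition matrix_op n (M : 'M[C]_n) f : C -> C := fun z =>
  \sum_(i < n) (\sum_(j < n) M i j * inner_prod f (fun z => z ^ (j : nat))) * z ^ (i : nat).

Lemma inner_prod_matrix_op n (M : 'M[C]_n) f (i : 'I_n) :
  inner_prod (matrix_op M f) (fun z => z ^ (i : nat)) =
  \sum_(j < n) M i j * inner_prod f (fun z => z ^ (j : nat)).
Proof.
rewrite (inner_prod_lincomb_zpow _ (fun i : 'I_n => i : nat)); last exact: L2_zpow.
under eq_bigr do rewrite inner_prod_zpow.
by apply: (sum_delta _ (e := fun j => j%:Z)) => // j k [] /val_inj.
Qed.

Lemma op_matrix_matrix_op n (M : 'M[C]_n) : op_matrix n (matrix_op M) = M.
Proof.
apply/matrixP => i j; rewrite mxE inner_prod_matrix_op.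
under eq_bigr => k _ do rewrite (inner_prod_zpow R j k) eq_sym.
by apply: (sum_delta _ (e := fun j => j%:Z)) => // k l [] /val_inj.
Qed.

(** Conversely, a matrix whose entries are the prescribed Fourier coefficients
    of phi represents the compression of phi: by model_expand, it is enough to
    compare both on the powers of z. *)
Lemma matrix_op_Toeplitz n (M : 'M[C]_n) phi : Linfty R phi ->
  (forall i j : 'I_n, circle_int (fun z => phi z * z ^ (j%:Z - i%:Z)) = M i j) ->
  is_truncated_Toeplitz (monom R n) phi (matrix_op M).
Proof.
move=> Lphi phiM f Kf; have L2f := Kf.1.1; split; first exact: model_lincomb.
have L2A : L2 R (matrix_op M f) by case: (model_lincomb (fun i : 'I_n =>
  \sum_(j < n) M i j * inner_prod f (fun z => z ^ (j : nat)))) => -[].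
have L2pf : L2 R (phi \* f) by exact: L2M.
move=> h; apply: orthogonal_model => [|i]; first exact: L2B.
rewrite inner_prodBl //; last exact: L2_zpow.
rewrite inner_prod_matrix_op inner_prodMl (model_expand Kf); last first.
  exact: (L2M (LinftyJ Lphi) (L2_zpow R i)).
apply/eqP; rewrite subr_eq0; apply/eqP; apply: eq_bigr => j _.
by rewrite -phiM -inner_prod_symbol inner_prodMl mulrC.
Qed.

Lemma is_orth_proj_sum N (a : 'I_N -> C) (u g : 'I_N -> C -> C) :
  (forall i, L2 R (u i)) ->
  (forall i, is_orth_proj (H2minus R) (u i) (g i)) ->
  is_orth_proj (H2minus R) (fun z => \sum_(i < N) a i * u i z)
    (fun z => \sum_(i < N) a i * g i z).
Proof.
move=> L2u pg; have L2g i : L2 R (g i) by case: (pg i) => -[].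
have L2au i : L2 R (fun z => a i * u i z) by exact: L2Z.
have L2ag i : L2 R (fun z => a i * g i z) by exact: L2Z.
have sumE v h : (forall i, L2 R (v i)) -> L2 R h ->
    inner_prod (fun z => \sum_(i < N) a i * v i z) h =
    \sum_(i < N) a i * inner_prod (v i) h.
  move=> L2v L2h; rewrite (inner_prod_suml (F := fun i z => a i * v i z)) //.
    by apply: eq_bigr => i _; rewrite inner_prodZl.
  by move=> i; exact: L2Z.
have L2sg : L2 R (fun z => \sum_(i < N) a i * g i z).
  exact: (L2_sum (F := fun i z => a i * g i z)).
split.
  split=> // h H2h; rewrite sumE //; last by case: H2h.
  by rewrite big1 // => i _; rewrite (pg i).1.2 ?mulr0.
move=> h Hh; have L2h := Hh.1; rewrite inner_prodBl //; last first.
  exact: (L2_sum (F := fun i z => a i * u i z)).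
rewrite !sumE // -sumrB big1 // => i _.
by rewrite -mulrBr -inner_prodBl // (pg i).2 ?mulr0.
Qed.

(** The projection keeps negative frequencies and kills the others. *)
Lemma zpow_H2minus_proj k : exists g, is_orth_proj (H2minus R) (fun z => z ^ k) g.
Proof.
have [lt_k0|] := ltP k 0.
  exists (fun z => z ^ k); split; first exact: H2minus_zpow.
  move=> h _; rewrite -[RHS](inner_prod0l h).
  by apply: inner_prod_eq => // t /=; rewrite subrr.
case: k => // k _; exists (fun=> 0); split.
  by split; [exact: L2_cst | move=> h _; exact: inner_prod0l].
move=> h Hh; rewrite -[RHS](zpow_orth_H2minus k Hh).
by apply: inner_prod_eq => // t /=; rewrite subr0.
Qed.

Lemma trig_H2minus_proj N (c : 'I_N -> C) (e : 'I_N -> int) :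
  exists g, is_orth_proj (H2minus R) (fun z => \sum_(i < N) c i * z ^ e i) g.
Proof.
have /choice[g pg] := fun i => zpow_H2minus_proj (e i).
exists (fun z => \sum_(i < N) c i * g i z).
exact: (is_orth_proj_sum c (fun i => L2_zpow R (e i)) pg).
Qed.

(** For a symbol that is a trigonometric polynomial, the projection that
    occurs in a truncated Hankel operator exists: the product psi f is, up to
    a null function, a trigonometric polynomial, and each of its terms is
    projected separately. *)
Lemma model_H2minus_proj n N (c : 'I_N -> C) (e : 'I_N -> int) f :
  model_space (monom R n) f ->
  exists g, is_orth_proj (H2minus R) ((fun z => \sum_(i < N) c i * z ^ e i) \* f) g.
Proof.
move=> Kf; set psi := (X in X \* f); have L2f := Kf.1.1.
have Lpsi : Linfty R psi by exact: Linfty_lincomb_zpow.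
have L2psij (j : 'I_n) : L2 R (psi \* (fun z => z ^ (j : nat))).
  exact/L2M/(L2_zpow R j).
have /choice[g pg] : forall j : 'I_n, exists g,
    is_orth_proj (H2minus R) (psi \* (fun z => z ^ (j : nat))) g.
  move=> j; have [g [Hg pg]] := trig_H2minus_proj c (fun i => e i + j%:Z).
  exists g; split=> // h Hh; rewrite -(pg h Hh); apply: inner_prod_eq => // t /=.
  congr (_ - _); rewrite mulr_suml; apply: eq_bigr => k _.
  by rewrite -mulrA -expfzDr ?circle_pt_neq0.
pose fj (j : 'I_n) := inner_prod f (fun z => z ^ (j : nat)).
have [Hg {}pg] := is_orth_proj_sum fj L2psij pg.
exists (fun z => \sum_(j < n) fj j * g j z); split=> // h Hh.
have L2h := Hh.1.
rewrite -[RHS](pg h Hh) inner_prodBl //; last 2 first.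
- exact: L2M.
- by case: Hg.
rewrite [RHS]inner_prodBl //; last 2 first.
- by apply: (L2_sum (F := fun i z => fj i * (psi \* (fun z => z ^ (i : nat))) z)) => j; exact: L2Z.
- by case: Hg.
congr (_ - _); rewrite inner_prodMl (model_expand Kf); last exact: (L2M (LinftyJ Lpsi)).
rewrite (inner_prod_suml (F := fun i z => fj i * (psi \* (fun z => z ^ (i : nat))) z)) //.
  by apply: eq_bigr => j _; rewrite inner_prodZl // inner_prodMl.
by move=> j; exact: L2Z.
Qed.

(** Once J is moved across the inner product, the i-th coefficient of the
    result is the pairing of psi f with z^(-(i + 1)), to which model_expand
    applies as in the Toeplitz case. The hypothesis on projections is supplied
    by model_H2minus_proj when psi is a trigonometric polynomial. *)
Lemma matrix_op_Hankel n (M : 'M[C]_n) psi : Linfty R psi ->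
  (forall f, model_space (monom R n) f ->
    exists g, is_orth_proj (H2minus R) (psi \* f) g) ->
  (forall i j : 'I_n, circle_int (fun z => psi z * z ^ (i + j + 1)%N) = M i j) ->
  is_truncated_Hankel (monom R n) psi (matrix_op M).
Proof.
move=> Lpsi proj psiM f Kf; have L2f := Kf.1.1.
have [g pg] := proj f Kf; exists g => //; split; first exact: model_lincomb.
have L2g : L2 R g by case: pg => -[].
have L2A : L2 R (matrix_op M f) by exact: L2_lincomb_zpow.
have L2pf : L2 R (psi \* f) by exact: L2M.
have L2Jg := L2_Jop L2g.
move=> h; apply: orthogonal_model => [|i]; first exact: L2B.
rewrite inner_prodBl //; last exact: L2_zpow.
have Hi : H2minus R (fun z => z ^ (- (i%:Z + 1))).
  by apply: H2minus_zpow; rewrite oppr_lt0.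
rewrite inner_prod_matrix_op inner_prod_Jop // (orth_proj_inner pg) //; last exact: L2_zpow.
rewrite inner_prodMl (model_expand Kf); last first.
  exact: (L2M (LinftyJ Lpsi) (L2_zpow R _)).
apply/eqP; rewrite subr_eq0; apply/eqP; apply: eq_bigr => j _.
rewrite -psiM mulrC -inner_prodMl inner_prod_symbol; congr (circle_int _ * _).
by apply/funext => z; rewrite opprK !PoszD; congr (_ * _ ^ _); ring.
Qed.

(** Both symbols are trigonometric polynomials. As i - j and i + j have the
    same parity, coefficients that depend only on the parity of the frequency
    produce the same checkerboard in the Toeplitz and in the Hankel case. The
    frequencies are indexed by natural numbers: the shift by n makes i - j
    nonnegative, and 2n terms cover all the values that occur. *)
Lemma checkerboard_TH_inter n (a b : C) : TH_inter R n (checkerboard n a b).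
Proof.
set M := checkerboard n a b; exists (matrix_op M); last exact: op_matrix_matrix_op.
pose coef (s : nat) := if odd s then b else a.
split.
  exists (fun z => \sum_(k < n + n) coef (k + n)%N * z ^ (k%:Z - n%:Z)).
    exact: Linfty_lincomb_zpow.
  apply: matrix_op_Toeplitz => [|i j]; first exact: Linfty_lincomb_zpow.
  have lt_k : (n + i - j < n + n)%N by have := ltn_ord i; have := ltn_ord j; lia.
  rewrite (circle_int_trig _ (k0 := Ordinal lt_k)) => /=.
  - rewrite mxE /coef; congr (if _ then _ else _).
    have : (n + i - j + n + j + j = n + n + (i + j))%N by have := ltn_ord j; lia.
    by move=> /(congr1 odd); rewrite !oddD; do 4!case: odd.
  - by move=> k l /addIr [] /val_inj.
  - by have := ltn_ord j; lia.
exists (fun z => \sum_(k < n + n) coef k * z ^ (- (k%:Z + 1))).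
  exact: Linfty_lincomb_zpow.
apply: matrix_op_Hankel => [|f|i j].
- exact: Linfty_lincomb_zpow.
- exact: model_H2minus_proj.
have lt_k : (i + j < n + n)%N by have := ltn_ord i; have := ltn_ord j; lia.
rewrite (circle_int_trig _ (k0 := Ordinal lt_k)) => /=.
- by rewrite mxE.
- by move=> k l /oppr_inj /addIr [] /val_inj.
- by rewrite !PoszD addNr.
Qed.

End Entries.

Theorem mainTheorem11 (R : realType) (n : nat) (hn : (2 <= n)%N) :
  [/\ TH_inter R n = [set M : 'M[R[i]]_n | toeplitz_mx M /\ hankel_mx M],
      TH_inter R n = [set M : 'M[R[i]]_n | M \in <<[:: E_even R n; E_odd R n]>>%VS],
      free [:: E_even R n; E_odd R n] &
      exists U : {vspace 'M[R[i]]_n},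
        TH_inter R n = [set M : 'M[R[i]]_n | M \in U] /\ (\dim U = 2)%N].
Proof.
case: n hn => [|[|n]] // _.
have TH_checker (M : 'M[R[i]]_n.+2) : toeplitz_mx M -> hankel_mx M ->
    exists a b, M = checkerboard n.+2 a b.
  move=> TM HM; exists (M ord0 ord0), (M ord0 (lift ord0 ord0)).
  by apply/matrixP => i j; rewrite mxE (Toeplitz_Hankel_parity TM HM); case: odd.
have spanE : TH_inter R n.+2 =
    [set M | M \in <<[:: E_even R n.+2; E_odd R n.+2]>>%VS].
  apply/seteqP; split=> M /=.
    move=> /TH_inter_Toeplitz_Hankel[TM HM]; apply/span_checkerboard.
    exact: TH_checker.
  by move=> /span_checkerboard[a [b ->]]; exact: checkerboard_TH_inter.
have free_EO : free [:: E_even R n.+2; E_odd R n.+2].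
  rewrite free_cons seq1_free span_seq1; apply/andP; split.
    apply/negP => /vlineP[c /matrixP/(_ ord0 ord0)].
    by rewrite !mxE /= mulr0 => /eqP; rewrite oner_eq0.
  apply/eqP => /matrixP/(_ ord0 (lift ord0 ord0)).
  by rewrite !mxE /= => /eqP; rewrite oner_eq0.
split=> //.
  apply/seteqP; split=> M /=; first exact: TH_inter_Toeplitz_Hankel.
  by move=> [TM HM]; have [a [b ->]] := TH_checker M TM HM; exact: checkerboard_TH_inter.
exists <<[:: E_even R n.+2; E_odd R n.+2]>>%VS; split=> //.
exact: (eqP free_EO).
Qed.
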